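(* Let $L>0$ be a real number and let $N>3$ be an integer. Then there exists a positive number $\delta$ such that $$\Lambda_N\le 2N\cot\left(\frac{\delta\pi}{L+2\delta}\right),$$ where $\Lambda_N$ is the Lebesgue constant (depending on $N$, $L$ and $\delta$) of interpolation by $\{w_1,\dots,w_N\}$ at the uniform grid points $x_1,\dots,x_N$ of $[0,L]$.
   Context: For $L,\delta>0$ let $\widetilde I=(-\delta,L+\delta)$ and, for $j\in\mathbb{N}$, $w_j(x)=\sqrt{\frac{2}{L+2\delta}}\,\sin\left(\frac{j\pi(x+\delta)}{L+2\delta}\right)$. The uniform grid is $x_j=\frac{(j-1)L}{N-1}$, $j=1,\dots,N$. Write $z=x+\delta$ and $z_k=x_k+\delta$ for $k=1,\dots,N$. The trigonometric Lagrange interpolation functions associated with $\{w_j\}_{j=1}^N$ and the grid are $$l_j(z)=\frac{\sin\left(\frac{\pi z}{L+2\delta}\right)\prod_{k\ne j}\left(\cos\left(\frac{\pi z}{L+2\delta}\right)-\cos\left(\frac{\pi z_k}{L+2\delta}\right)\right)}{\sin\left(\frac{\pi z_j}{L+2\delta}\right)\prod_{k\ne j}\left(\cos\left(\frac{\pi z_j}{L+2\delta}\right)-\cos\left(\frac{\pi z_k}{L+2\delta}\right)\right)},\qquad j=1,\dots,N,$$ where $k$ ranges over $\{1,\dots,N\}\setminus\{j\}$. The Lebesgue constant is $$\Lambda_N=\max_{z\in[0,L]}\sum_{j=1}^N|l_j(z)|.$$ *)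

(* Defs.v *)
From HB Require Import structures.
From mathcomp Require Import all_boot all_order all_algebra.
From mathcomp Require Import all_classical all_reals all_analysis.

Set Implicit Arguments.
Unset Strict Implicit.
Unset Printing Implicit Defensive.

Import Order.TTheory GRing.Theory Num.Theory.
Import numFieldNormedType.Exports.

Local Open Scope classical_set_scope.
Local Open Scope ring_scope.

Definition cot {R : realType} (x : R) : R := cos x / sin x.

(* Grid indices run over 1, ..., N, hence the ranges 1 <= j < N.+1 below. *)
Definition grid {R : realType} (L : R) (N j : nat) : R :=
  (j%:R - 1) * L / (N%:R - 1).

(* Grid points in the shifted coordinate z = x + delta. *)
Definition shifted_grid {R : realType} (L delta : R) (N j : nat) : R :=
  grid L N j + delta.

Definition lagrange_num {R : realType} (L delta : R) (N j : nat) (z : R) : R :=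
  sin (pi * z / (L + 2 * delta)) *
  \prod_(1 <= k < N.+1 | k != j)
    (cos (pi * z / (L + 2 * delta)) -
     cos (pi * shifted_grid L delta N k / (L + 2 * delta))).

Definition trig_lagrange {R : realType} (L delta : R) (N j : nat) (z : R) : R :=
  lagrange_num L delta N j z /
  lagrange_num L delta N j (shifted_grid L delta N j).

Definition lebesgue_function {R : realType} (L delta : R) (N : nat) (z : R) :
    R :=
  \sum_(1 <= j < N.+1) `|trig_lagrange L delta N j z|.

(* The variable z of the Lebesgue function ranges over [0, L], although the
   shifted grid points lie in [delta, L + delta].  The supremum is a maximum, see
   lebesgue_constant_max. *)
Definition lebesgue_constant {R : realType} (L delta : R) (N : nat) : R :=
  sup [set lebesgue_function L delta N z | z in `[0, L]].

Lemma continuous_lebesgue_function {R : realType} (L delta : R) (N : nat) :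
  continuous (lebesgue_function L delta N).
Proof.
have cphase : continuous (fun z : R => pi * z / (L + 2 * delta)).
  by move=> z; apply: cvgMr_tmp; apply: cvgMl_tmp; exact: cvg_id.
have cnum j : continuous (lagrange_num L delta N j).
  move=> z; apply: cvgM.
    by apply: continuous_cvg; [exact: continuous_sin | exact: cphase].
  apply: cvg_big => [|k _]; first exact: mul_continuous.
  apply: cvgB; last exact: cvg_cst.
  by apply: continuous_cvg; [exact: continuous_cos | exact: cphase].
move=> z; apply: cvg_big => [|j _]; first exact: add_continuous.
by apply: cvg_norm; apply: cvgMr_tmp; exact: cnum.
Qed.

Lemma lebesgue_constant_max {R : realType} (L delta : R) (N : nat) : 0 <= L ->
  (exists2 z, z \in `[0, L] &
    lebesgue_function L delta N z = lebesgue_constant L delta N) /\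
  (forall z, z \in `[0, L] ->
    lebesgue_function L delta N z <= lebesgue_constant L delta N).
Proof.
move=> L0.
have [c c0L cmax] : exists2 c, c \in `[0, L] & forall t, t \in `[0, L] ->
    lebesgue_function L delta N t <= lebesgue_function L delta N c.
  apply: EVT_max => //.
  exact/continuous_subspaceT/continuous_lebesgue_function.
suff cE : lebesgue_function L delta N c = lebesgue_constant L delta N.
  by split; [exists c | move=> z zL; rewrite -cE; exact: cmax].
have ub : ubound [set lebesgue_function L delta N z | z in `[0, L]]
    (lebesgue_function L delta N c).
  by move=> _ [z zL <-]; exact: cmax.
apply/eqP; rewrite eq_le; apply/andP; split.
  by apply: ub_le_sup; [exists (lebesgue_function L delta N c) | exists c].
by apply: ge_sup => //; exists (lebesgue_function L delta N c); exists c.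
Qed.

(* Main.v *)
Require Import Defs.
From HB Require Import structures.
From mathcomp Require Import all_boot all_order all_algebra.
From mathcomp Require Import all_classical all_reals all_analysis.
From mathcomp Require Import ring lra.
Import Order.TTheory GRing.Theory Num.Theory.
Local Open Scope ring_scope.

(** The choice delta = L / (2 (N - 1)) turns the shifted uniform grid, rescaled
    by theta = pi z / (L + 2 delta), into the angles theta_k = (2k-1) pi / (2N),
    so that the cos theta_k are the zeros of the Chebyshev polynomial T_N.
    For some constant c this gives
      cos (N theta) = T_N(cos theta) = c * prod_k (cos theta - cos theta_k),
    and the constant cancels in the quotient l_j.  Differentiating at theta_j,
      |c sin theta_j prod_(k != j) (cos theta_j - cos theta_k)|
        = |N sin (N theta_j)| = N,
    which is the denominator of l_j up to c.  For the numerator write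
    t = (theta - theta_j) / 2 and u = (theta + theta_j) / 2.  Then
      cos theta - cos theta_j = - 2 sin t sin u,
      |cos (N theta)| = |sin (2 N t)| <= 2 N |sin t|  as cos (N theta_j) = 0,
      sin theta <= 2 sin u,
    whence |l_j| <= 2 ([node_numerator_ratio_le]).  Therefore Lambda_N <= 2 N, and
    the cotangent in the theorem is cot (pi / (2N)) >= cot (pi / 4) = 1. *)

(** * Chebyshev polynomials *)

(** The pair (T_n, U_(n-1)) of Chebyshev polynomials of the first and second
    kind.  The recursion is the addition formula for cos and sin, with sin
    factored out of the second component. *)
Fixpoint chebyshev {R : comNzRingType} (n : nat) : {poly R} * {poly R} :=
  if n is m.+1 then
    ('X * (chebyshev m).1 - (1 - 'X^2) * (chebyshev m).2,
     'X * (chebyshev m).2 + (chebyshev m).1)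
  else (1, 0).

Lemma chebyshev_cos_sin {R : realType} (n : nat) (t : R) :
  (chebyshev n).1.[cos t] = cos (n%:R * t) /\
  sin t * (chebyshev n).2.[cos t] = sin (n%:R * t).
Proof.
elim: n => [|n [IHT IHU]] /=.
  by rewrite mul0r cos0 sin0 !hornerE.
rewrite -natr1 (mulrDl _ _ t) mul1r cosD sinD -IHT -IHU !hornerE.
split; last ring.
by rewrite -sin2cos2; ring.
Qed.

Lemma size_chebyshev {R : comNzRingType} (n : nat) :
  (size (chebyshev (R := R) n).1 <= n.+1)%N /\
  (size (chebyshev (R := R) n).2 <= n)%N.
Proof.
elim: n => [|n [IHT IHU]] /=; first by rewrite size_poly1 size_poly0.
have sX2 : (size (1 - 'X^2 : {poly R})%R <= 3)%N.
  by rewrite (leq_trans (size_polyD _ _))// size_poly1 size_polyN size_polyXn.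
have mulX m (p : {poly R}) : (size p <= m -> size ('X * p)%R <= m.+1)%N.
  by move=> pm; rewrite (leq_trans (size_polyMleq _ _))// size_polyX.
split.
  rewrite (leq_trans (size_polyD _ _))// geq_max mulX//= size_polyN.
  rewrite (leq_trans (size_polyMleq _ _))//.
  by rewrite -subn1 leq_subLR add1n (leq_trans (leq_add sX2 IHU)).
by rewrite (leq_trans (size_polyD _ _))// geq_max mulX.
Qed.

(** T_n' = n U_(n-1).  The second identity is the Chebyshev differential equation
    in disguise, and makes the induction go through. *)
Lemma deriv_chebyshev {R : comNzRingType} (n : nat) :
  (chebyshev (R := R) n).1^`() = n%:R * (chebyshev n).2 /\
  (1 - 'X^2) * (chebyshev (R := R) n).2^`() =
    'X * (chebyshev n).2 - n%:R * (chebyshev n).1.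
Proof.
elim: n => [|n [IHT IHU]] /=.
  by rewrite derivC deriv0 !mul0r !mulr0 subr0.
rewrite -natr1 !poly.derivE IHT; split.
  rewrite [(1 - _) * _]IHU; ring.
have -> : forall a b c : {poly R}, (1 - 'X^2) * (a + 'X * b + c) =
    (1 - 'X^2) * (a + c) + 'X * ((1 - 'X^2) * b) by move=> *; ring.
rewrite IHU; ring.
Qed.

(** * Chebyshev nodes *)

Definition chebyshev_angle {R : realType} (N k : nat) : R :=
  (k%:R * 2 - 1) * pi / (N%:R * 2).

Lemma cos_natr_pi_pred_half {R : realType} (k : nat) :
  cos ((k%:R * 2 - 1) * (pi / 2) : R) = 0.
Proof.
have -> : (k%:R * 2 - 1) * (pi / 2) = k%:R * pi - pi / 2 :> R by field.
rewrite cosBpihalf; elim: k => [|k IH]; first by rewrite mul0r sin0.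
by rewrite -natr1 mulrDl mul1r sinDpi IH oppr0.
Qed.

Lemma cos_chebyshev_angle {R : realType} {N : nat} (k : nat) : (0 < N)%N ->
  cos (N%:R * chebyshev_angle N k : R) = 0.
Proof.
move=> N0; rewrite -(cos_natr_pi_pred_half k) /chebyshev_angle; congr cos.
by field; rewrite pnatr_eq0 -lt0n.
Qed.

Lemma chebyshev_angle_itv {R : realType} {N k : nat} : (0 < k <= N)%N ->
  0 < (chebyshev_angle N k : R) < pi.
Proof.
move=> /andP[k0 kN]; have N0 : 0 < N%:R :> R by rewrite ltr0n (leq_trans k0).
have k1 : 1 <= k%:R :> R by rewrite ler1n.
have kN' : k%:R <= N%:R :> R by rewrite ler_nat.
have p0 := @pi_gt0 R.
rewrite /chebyshev_angle divr_gt0 ?mulr_gt0//=; last lra.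
by rewrite ltr_pdivrMr ?mulr_gt0//; nra.
Qed.

Lemma chebyshev_angle_inj {R : realType} {N : nat} : (0 < N)%N ->
  injective (chebyshev_angle N : nat -> R).
Proof.
move=> N0 i j; rewrite /chebyshev_angle => ij.
have p0 := @pi_gt0 R; have N0' : 0 < N%:R :> R by rewrite ltr0n.
apply/eqP; rewrite -(eqr_nat R); apply/eqP.
have {}ij : (i%:R * 2 - 1) * pi = (j%:R * 2 - 1) * pi :> R.
  by apply: (mulIf (invr_neq0 _) ij); rewrite gt_eqF// mulr_gt0.
have := mulIf (lt0r_neq0 p0) ij; lra.
Qed.

Lemma cos_chebyshev_angle_uniq {R : realType} (N : nat) :
  uniq [seq cos (chebyshev_angle N k : R) | k <- index_iota 1 N.+1].
Proof.
rewrite map_inj_in_uniq ?iota_uniq// => i j.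
rewrite !mem_index_iota !ltnS => iN jN /cos_inj ij.
have N0 : (0 < N)%N by case/andP: iN => /leq_trans; apply.
have /andP[i0 ipi] := chebyshev_angle_itv (R := R) iN.
have /andP[j0 jpi] := chebyshev_angle_itv (R := R) jN.
by apply: (chebyshev_angle_inj N0); apply: ij; rewrite in_itv/= !ltW.
Qed.

(** The constant is the leading coefficient 2^(N-1); since it cancels in the
    interpolation functions, it is left unspecified. *)
Lemma chebyshev_factor {R : realType} {N : nat} : (0 < N)%N ->
  exists c : R, (chebyshev N).1 =
    c%:P * \prod_(1 <= k < N.+1) ('X - (cos (chebyshev_angle N k))%:P).
Proof.
move=> N0; set T := (chebyshev N).1.
set xs := [seq cos (chebyshev_angle N k : R) | k <- index_iota 1 N.+1].
have [|| q Tq] := @uniq_roots_prod_XsubC _ T xs.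
- apply/allP => _ /mapP[k _ ->]; apply/rootP.
  by rewrite (chebyshev_cos_sin N _).1 cos_chebyshev_angle.
- by rewrite uniq_rootsE cos_chebyshev_angle_uniq.
suff /size1_polyC qE : (size q <= 1)%N.
  by exists q`_0; rewrite Tq big_map {1}qE.
have [->|q0] := eqVneq q 0; first by rewrite size_poly0.
have := (size_chebyshev (R := R) N).1.
rewrite -/T Tq size_Mmonic ?monic_prod_XsubC// size_prod_XsubC.
by rewrite size_map size_iota subSS subn0 addnS /= -add1n leq_add2r.
Qed.

(** * Trigonometric estimates *)

Lemma normr_sin_natr_le {R : realType} (n : nat) (t : R) :
  `|sin (n%:R * t)| <= n%:R * `|sin t|.
Proof.
elim: n => [|n IH]; first by rewrite !mul0r sin0 normr0.
rewrite -natr1 (mulrDl _ _ t) mul1r sinD mulrDl mul1r.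
rewrite (le_trans (ler_normD _ _))// !normrM lerD//.
  by rewrite (le_trans _ IH)// ler_piMr ?cos_max.
by rewrite ler_piMl ?cos_max.
Qed.

(** A weak form of the concavity of sin on [0, pi]. *)
Lemma sin_le_2sin_mean {R : realType} {a b : R} :
  0 <= a <= pi -> 0 <= b <= pi -> sin a <= 2 * sin ((a + b) / 2).
Proof.
move=> /andP[a0 api] /andP[b0 bpi].
have -> : sin a = 2 * (sin (a / 2) * cos (a / 2)).
  by rewrite {1}(splitr a) sinD; ring.
have -> : (a + b) / 2 = a / 2 + b / 2 by field.
have half (x : R) : 0 <= x -> x <= pi -> 0 <= sin (x / 2) /\ 0 <= cos (x / 2).
  have p0 := @pi_gt0 R.
  by move=> ? ?; split; [apply: sin_ge0_pi | apply: cos_ge0_pihalf]; lra.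
have [sa ca] := half a a0 api; have [sb cb] := half b b0 bpi.
have sa2 := cos2Dsin2 (a / 2); have sb2 := cos2Dsin2 (b / 2).
rewrite ler_pM2l// sinD.
(* On the first quadrant, comparing two sines the other way round compares the
   cosines, so one of the two summands already dominates. *)
have [ab|ab] := leP (sin (a / 2)) (sin (b / 2)).
  by rewrite mulrC (le_trans (ler_wpM2l ca ab))// lerDr mulr_ge0.
have : cos (a / 2) <= cos (b / 2) by rewrite -ler_sqr// !cos2sin2; nra.
by move=> /(ler_wpM2l sa) /le_trans; apply; rewrite lerDl mulr_ge0.
Qed.

Lemma cosB_cos {R : realType} (a b : R) :
  cos a - cos b = - 2 * sin ((a - b) / 2) * sin ((a + b) / 2).
Proof.
have -> : cos a = cos ((a + b) / 2 + (a - b) / 2) by congr cos; field.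
have -> : cos b = cos ((a + b) / 2 - (a - b) / 2) by congr cos; field.
by rewrite cosD cosB; ring.
Qed.

(** As b is a zero of cos (n x), the function |cos (n x)| is |sin (n (x - b))|. *)
Lemma normr_cos_natr_le {R : realType} {n : nat} (a : R) {b : R} :
  cos (n%:R * b) = 0 ->
  `|cos (n%:R * a)| <= 2 * n%:R * `|sin ((a - b) / 2)|.
Proof.
move=> cb.
have -> : n%:R * a = (2 * n)%:R * ((a - b) / 2) + n%:R * b.
  by rewrite natrM; field.
rewrite cosD cb mulr0 sub0r normrN normrM -natrM.
by rewrite (le_trans _ (normr_sin_natr_le _ _))// ler_piMr ?sin_max.
Qed.

Lemma cot_ge1 {R : realType} (x : R) : 0 < x <= pi / 4 -> 1 <= cot x.
Proof.
move=> /andP[x0 x4]; have p0 := @pi_gt0 R.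
rewrite /cot ler_pdivlMr ?mul1r; last by apply: sin_gt0_pi; lra.
by rewrite -cosBpihalf -cosN opprB leNgt ltr_cos ?in_itv/= -?leNgt; lra.
Qed.

(** * Interpolation at the Chebyshev nodes *)

Definition node_numerator {R : realType} (N j : nat) (t : R) : R :=
  sin t * \prod_(1 <= k < N.+1 | k != j) (cos t - cos (chebyshev_angle N k)).

(** Removing the factor of its j-th zero from T_N gives [node_numerator N j], up
    to sin t and the constant c.  At the j-th zero this is the derivative of
    T_N, by which the normalization comes out as N. *)
Lemma node_numerator_chebyshev {R : realType} {N : nat} : (0 < N)%N ->
  exists c : R, forall j, (0 < j <= N)%N ->
    `|c * node_numerator N j (chebyshev_angle N j)| = N%:R /\
    forall t, c * node_numerator N j t * (cos t - cos (chebyshev_angle N j)) =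
      sin t * cos (N%:R * t).
Proof.
move=> N0; have [c Tc] := chebyshev_factor (R := R) N0.
exists c => j jN; set th := chebyshev_angle N j.
pose Q : {poly R} := \prod_(1 <= k < N.+1 | k != j)
  ('X - (cos (chebyshev_angle N k))%:P).
have QE t : Q.[cos t] = \prod_(1 <= k < N.+1 | k != j)
    (cos t - cos (chebyshev_angle N k)).
  by rewrite horner_prod; apply: eq_bigr => k _; rewrite !hornerE.
have {}Tc : (chebyshev N).1 = c%:P * (('X - (cos th)%:P) * Q).
  rewrite Tc (bigD1_seq j) ?iota_uniq//= mem_index_iota ltnS; exact: jN.
rewrite /node_numerator; split=> [|t]; rewrite -QE; last first.
  by rewrite -(chebyshev_cos_sin N t).1 Tc !hornerM hornerC hornerXsubC; ring.
have -> : c * (sin th * Q.[cos th]) = sin th * (chebyshev N).1^`().[cos th].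
  rewrite Tc !poly.derivE !(hornerD, hornerM, hornerC, hornerX, hornerN) subrr.
  ring.
rewrite (deriv_chebyshev N).1 -polyC_natr hornerM hornerC mulrCA.
rewrite (chebyshev_cos_sin N th).2 normrM normr_nat.
suff -> : `|sin (N%:R * th)| = 1 by rewrite mulr1.
apply/eqP; rewrite -sqrp_eq1// real_normK ?num_real// sin2cos2.
by rewrite cos_chebyshev_angle// expr0n subr0.
Qed.

(** In the trivial case cos t = cos theta_j the ratio is 1.  Otherwise both
    sides are multiplied by the factor cos t - cos theta_j missing from the
    numerator, and its half-angle factorization absorbs the bounds on sin t and
    on cos (N t). *)
Lemma node_numerator_ratio_le {R : realType} (N j : nat) (t : R) :
  (0 < j <= N)%N -> 0 <= t <= pi ->
  `|node_numerator N j t / node_numerator N j (chebyshev_angle N j)| <= 2.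
Proof.
move=> jN t0pi.
have N0 : (0 < N)%N by case/andP: jN => /leq_trans; apply.
have N0' : 0 < N%:R :> R by rewrite ltr0n.
have [c /(_ j jN)[]] := node_numerator_chebyshev (R := R) N0.
set P := node_numerator N j; set th := chebyshev_angle N j => cN cE.
have /andP[c0 P0] : (c != 0) && (P th != 0).
  by rewrite -negb_or -mulf_eq0 -normr_eq0 cN gt_eqF.
have -> : P t / P th = (c * P t) / (c * P th) by field; apply/andP.
rewrite normrM normfV cN ler_pdivrMr//.
have /andP[th0 thpi] := chebyshev_angle_itv (R := R) jN.
have thI : 0 <= th <= pi by rewrite !ltW.
have [/cos_inj tth|tth] := eqVneq (cos t) (cos th).
  by rewrite tth ?in_itv//= cN ler_peMl ?ler1n.
rewrite -(@ler_pM2r _ `|cos t - cos th|); last by rewrite normr_gt0 subr_eq0.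
rewrite -normrM cE normrM (ger0_norm (sin_ge0_pi t0pi)) cosB_cos !normrM normrN.
have := sin_le_2sin_mean t0pi thI; have sin0 := sin_ge0_pi t0pi.
have := normr_cos_natr_le t (cos_chebyshev_angle j N0).
rewrite -/th => cle sle.
have -> : 2 * N%:R * (`|2| * `|sin ((t - th) / 2)| * `|sin ((t + th) / 2)|) =
    (2 * `|sin ((t + th) / 2)|) * (2 * N%:R * `|sin ((t - th) / 2)|).
  by rewrite normr_nat; ring.
apply: ler_pM => //; rewrite (le_trans sle)// ler_pM2l//; exact: ler_norm.
Qed.

(** * The Lebesgue constant *)

Lemma lebesgue_constant_le {R : realType} (L delta M : R) (N : nat) : 0 <= L ->
  (forall j z, (0 < j <= N)%N -> 0 <= z <= L ->
    `|trig_lagrange L delta N j z| <= M) ->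
  lebesgue_constant L delta N <= N%:R * M.
Proof.
move=> L0 lM; have [[z zL <-] _] := lebesgue_constant_max delta N L0.
rewrite /lebesgue_function big_nat_cond.
have -> : N%:R * M = \sum_(1 <= j < N.+1) M.
  by rewrite big_const_nat iter_addr_0 subn1 mulr_natl.
rewrite [leRHS]big_nat_cond; apply: ler_sum => j /andP[jN _].
by apply: lM; [exact: jN | move: zL; rewrite in_itv].
Qed.

Theorem theorem1 (R : realType) (L : R) (N : nat) (hL : 0 < L)
    (hN : (3 < N)%N) :
  exists delta : R, 0 < delta /\
    lebesgue_constant L delta N <=
      2 * N%:R * cot (delta * pi / (L + 2 * delta)).
Proof.
have N4 : 4 <= N%:R :> R by rewrite ler_nat.
have p0 := @pi_gt0 R.
have N1 : N%:R - 1 != 0 :> R by rewrite gt_eqF//; lra.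
have N0 : N%:R != 0 :> R by rewrite gt_eqF//; lra.
have L0 : L != 0 by rewrite gt_eqF.
(* The value for which the grid overhangs by half a step at both ends, as the
   Chebyshev angles do in [0, pi]. *)
set delta := L / (2 * (N%:R - 1)).
have d0 : 0 < delta by rewrite divr_gt0//; lra.
have widthE : L + 2 * delta = 2 * N%:R * delta by rewrite /delta; field.
have w0 : 0 < L + 2 * delta by rewrite addr_gt0// mulr_gt0.
exists delta; split=> //.
have nodeE k : pi * shifted_grid L delta N k / (L + 2 * delta) =
    chebyshev_angle N k.
  rewrite widthE /shifted_grid /grid /chebyshev_angle /delta.
  by field; rewrite N1 N0 L0.
have -> : delta * pi / (L + 2 * delta) = pi / (2 * N%:R).
  by rewrite widthE; field; rewrite N0 gt_eqF.
apply: (@le_trans _ _ (N%:R * 2)).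
  apply: lebesgue_constant_le => [|j z jN /andP[z0 zL]]; first exact: ltW.
  rewrite /trig_lagrange /lagrange_num nodeE.
  under eq_bigr do rewrite nodeE.
  under [X in _ / (_ * X)]eq_bigr do rewrite nodeE.
  apply: node_numerator_ratio_le => //.
  rewrite divr_ge0 ?mulr_ge0 ?(ltW p0) ?(ltW w0)//=.
  by rewrite ler_pdivrMr// ler_pM2l// (le_trans zL)// lerDl mulr_ge0// ltW.
rewrite [N%:R * 2]mulrC ler_peMr//.
apply: cot_ge1; rewrite divr_gt0//=; last lra.
rewrite ler_pM2l// lef_pV2 ?posrE; lra.
Qed.
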